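(* Let $k\ge 1$ be an integer with binary expansion $k=2^{p_0}+2^{p_1}+\cdots+2^{p_s}$, where $0\le p_0<p_1<\cdots<p_s$ are integers. Then for every $k$-Leja section $E_k=(e_0,\dots,e_{k-1})$ of the closed unit disk $\mathcal U$ with $|e_0|=1$, the Lebesgue constant satisfies \[ \Lambda_{E_k}\le 2^{-\frac{p_0}{2}}\,k . \]
   Context: Let $\mathcal U=\{z\in\mathbb C: |z|\le 1\}$ be the closed unit disk. A $k$-Leja section of $\mathcal U$ is a finite sequence $E_k=(e_0,\dots,e_{k-1})$ of $k$ points of $\mathcal U$, with initial point satisfying $|e_0|=1$, such that for every $1\le m\le k-1$, \[ \prod_{j=0}^{m-1}|e_m-e_j|=\max_{z\in\mathcal U}\prod_{j=0}^{m-1}|z-e_j| . \] (At each step the maximizing point need not be unique; any choice is allowed. The points are automatically distinct.) The fundamental Lagrange interpolation polynomials associated with $E_k$ are \[ l_{j,E_k}(z)=\prod_{i=0,\,i\ne j}^{k-1}\frac{z-e_i}{e_j-e_i},\qquad 0\le j\le k-1, \] and the Lebesgue constant is \[ \Lambda_{E_k}=\sup_{z\in\mathcal U}\ \sum_{j=0}^{k-1}|l_{j,E_k}(z)| . \] Equivalently, $\Lambda_{E_k}$ is the norm (for the uniform norm on $\mathcal U$) of the Lagrange interpolation operator at $e_0,\dots,e_{k-1}$ from the continuous functions on $\mathcal U$ to the polynomials of degree at most $k-1$. *)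

(* Defs.v *)
From HB Require Import structures.
From mathcomp Require Import all_boot all_order all_algebra.
From mathcomp Require Export complex.
From mathcomp Require Import classical_sets reals ereal.

Set Implicit Arguments.
Unset Strict Implicit.
Unset Printing Implicit Defensive.

Import Order.TTheory GRing.Theory Num.Theory.

Local Open Scope classical_set_scope.
Local Open Scope ring_scope.

(* The modulus is taken to be [normc : R[i] -> R], so that moduli are real
   numbers; [`|z|] on R[i] is the same quantity embedded in R[i]. *)
Definition unit_disk (R : realType) : set R[i] := [set z | Normc.normc z <= 1].

(* |z - e_0| ... |z - e_(m-1)| *)
Definition leja_prod (R : realType) (k : nat) (e : 'I_k -> R[i]) (m : nat)
    (z : R[i]) : R :=
  \prod_(j < k | (j < m)%N) Normc.normc (z - e j).

(* The last clause says that e_m attains the maximum of [leja_prod e m] over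
   the disk: e_m lies in the disk by the first clause. *)
Definition leja_section (R : realType) (k : nat) (e : 'I_k -> R[i]) : Prop :=
  [/\ forall m : 'I_k, unit_disk (e m),
      forall m : 'I_k, m = 0%N :> nat -> Normc.normc (e m) = 1
    & forall m : 'I_k, (1 <= m)%N ->
        forall z : R[i], unit_disk z -> leja_prod e m z <= leja_prod e m (e m)].

Definition lagrange_fun (R : realType) (k : nat) (e : 'I_k -> R[i]) (j : 'I_k)
    (z : R[i]) : R[i] :=
  \prod_(i < k | i != j) ((z - e i) / (e j - e i)).

(* The supremum is taken in the extended reals, so that no default value is
   involved: it would be +oo if the set of values were unbounded. *)
Definition lebesgue_constant (R : realType) (k : nat) (e : 'I_k -> R[i]) :
    \bar R :=
  ereal_sup [set (\sum_(j < k) Normc.normc (lagrange_fun e j z))%:E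
            | z in @unit_disk R].

(* Main.v *)
(* The proof bounds the quadratic Lebesgue function, the sum of |l_j(z)|^2, by
   2^(-p_0) k on the unit circle; Cauchy-Schwarz then bounds the sum of |l_j(z)|
   there, and the maximum principle extends the bound to the disk.

   A Leja section satisfies e_(2i+1) = - e_(2i), and the squares
   f_i = e_(2i)^2 form a Leja section again. For k = 2m the quadratic function
   of e at z is that of f at z^2. For k = 2m+1, write K and b for the quadratic
   function of f_0, ..., f_(m-1) at z^2 and at f_m, g <= 1 for the modulus of
   the new fundamental polynomial at z, and t = Re (z / e_(2m)). A real number
   x with |x| <= g (K + b) / 2 exists such that the quadratic function of e at
   z is K + g^2 (b + 1) - x (1 + t), while that of f_0, ..., f_m at z^2 is
   K + g^2 (b + 1) - 2 x t. If m is even, K, b <= m/2 suffice. If m is odd,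
   the second expression is at most (m + 1)/2, and f_m = - f_(m-1) gives
   g <= |t|, which controls the first expression near z = - e_(2m). *)

Require Import Defs.
From HB Require Import structures.
From mathcomp Require Import all_boot all_order all_algebra.
From mathcomp Require Import complex ring lra zify.
From mathcomp Require Import classical_sets reals ereal exp.

Set Implicit Arguments.
Unset Strict Implicit.
Unset Printing Implicit Defensive.

Import Order.TTheory GRing.Theory Num.Theory.

Local Open Scope ring_scope.
Local Open Scope complex_scope.

Local Notation normc := Normc.normc.
Local Notation Re := complex.Re.
Local Notation Im := complex.Im.
Local Notation "z ^*" := (conjc z) : ring_scope.

(** * The modulus on [R[i]] *)

Lemma sqr_normcE (R : rcfType) (z : R[i]) :
  normc z ^+ 2 = Re z ^+ 2 + Im z ^+ 2.
Proof. by case: z => a b /=; rewrite sqr_sqrtr // addr_ge0 ?sqr_ge0. Qed.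

Lemma normc_ge0 (R : rcfType) (z : R[i]) : 0 <= normc z.
Proof. by case: z => a b; rewrite sqrtr_ge0. Qed.

Lemma normc_eq0 (R : rcfType) (z : R[i]) : (normc z == 0) = (z == 0).
Proof.
apply/eqP/eqP => [/Normc.eq0_normc //|->]; exact: Normc.normc0.
Qed.

Lemma normc_prod (R : rcfType) (I : Type) (r : seq I) (P : pred I)
    (F : I -> R[i]) :
  normc (\prod_(i <- r | P i) F i) = \prod_(i <- r | P i) normc (F i).
Proof. exact: (big_morph _ (@Normc.normcM R) (Normc.normc1 R)). Qed.

Lemma normcX (R : rcfType) (z : R[i]) n : normc (z ^+ n) = normc z ^+ n.
Proof.
elim: n => [|n IH]; first by rewrite !expr0 Normc.normc1.
by rewrite !exprS Normc.normcM IH.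
Qed.

Lemma le_normc_sum (R : rcfType) (I : Type) (r : seq I) (F : I -> R[i]) :
  normc (\sum_(i <- r) F i) <= \sum_(i <- r) normc (F i).
Proof.
elim/big_ind2: _ => [|x1 x2 y1 y2 h1 h2|//].
  by rewrite Normc.normc0.
exact: le_trans (le_normcD _ _) (lerD h1 h2).
Qed.

Lemma normc_sqr_eq1 (R : rcfType) (z : R[i]) :
  (normc (z ^+ 2) == 1) = (normc z == 1).
Proof. by rewrite normcX -{1}(expr1n R 2) eqrXn2 ?ler01 ?normc_ge0. Qed.

(* The parallelogram law makes the antipode the only point of the disk at
   distance 2 from a point of the circle. *)
Lemma antipode_normc (R : rcfType) (x y : R[i]) :
  normc x = 1 -> normc y <= 1 -> 2 <= normc (y - x) -> y = - x.
Proof.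
move=> x1 y1 d2; apply/eqP; rewrite -addr_eq0 -normc_eq0 -sqrf_eq0.
have hx : normc x ^+ 2 = 1 by rewrite x1 expr1n.
have hy : normc y ^+ 2 <= 1 by rewrite expr_le1 // normc_ge0.
have hd : 2 ^+ 2 <= normc (y - x) ^+ 2 by rewrite lerXn2r // nnegrE ?normc_ge0.
rewrite eq_le sqr_ge0 andbT.
move: hx hy hd; rewrite !sqr_normcE {d2 x1 y1}.
case: x y => [a b] [c d] /=; lra.
Qed.

(** * Nodal polynomials and the structure of Leja sequences *)

Definition nodal (R : rcfType) (e : nat -> R[i]) (m : nat) (z : R[i]) : R[i] :=
  \prod_(j < m) (z - e j).

(** Indexing by [nat] gives prefixes and sequences of squares one type; values from index [k] on are
    arbitrary. *)
Definition leja_seq (R : rcfType) (k : nat) (e : nat -> R[i]) : Prop :=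
  [/\ forall m, (m < k)%N -> normc (e m) <= 1,
      (0 < k)%N -> normc (e 0%N) = 1
    & forall m, (m < k)%N -> forall z, normc z <= 1 ->
        normc (nodal e m z) <= normc (nodal e m (e m))].

Definition even_squares (R : rcfType) (e : nat -> R[i]) : nat -> R[i] :=
  fun i => e i.*2 ^+ 2.

Definition antipodal (R : rcfType) (m : nat) (e : nat -> R[i]) : Prop :=
  forall i, (i < m)%N -> e i.*2.+1 = - e i.*2.

Lemma nodalS (R : rcfType) (e : nat -> R[i]) m z :
  nodal e m.+1 z = nodal e m z * (z - e m).
Proof. by rewrite /nodal big_ord_recr. Qed.

Lemma nodal_double (R : rcfType) (e : nat -> R[i]) m z : antipodal m e ->
  nodal e m.*2 z = nodal (even_squares e) m (z ^+ 2).
Proof.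
elim: m => [|m IH] he; first by rewrite /nodal !big_ord0.
rewrite doubleS !nodalS IH => [|i im]; last by rewrite he // ltnW.
by rewrite he // /even_squares; ring.
Qed.

Lemma leja_seq_le (R : rcfType) (e : nat -> R[i]) m k :
  (m <= k)%N -> leja_seq k e -> leja_seq m e.
Proof.
move=> mk [h1 h2 h3]; split=> [i im|m0|i im].
- exact: h1 (leq_trans im mk).
- exact: h2 (leq_trans m0 mk).
- exact: h3 (leq_trans im mk).
Qed.

(** Squaring maps the disk onto itself, so [nodal_double] carries maximality of [e] at index 2i to
    the squares at index i. *)
Lemma leja_even_squares (R : rcfType) (e : nat -> R[i]) m :
  leja_seq m.*2.+1 e -> antipodal m e -> leja_seq m.+1 (even_squares e).
Proof.
move=> [h1 h2 h3] he; split=> [i|_|i] /=.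
- rewrite ltnS => im; rewrite normcX expr_le1 ?normc_ge0 // h1 //.
  by rewrite ltnS leq_double.
- by rewrite normcX h2 // expr1n.
rewrite ltnS => im z z1.
have hi : antipodal i e by move=> j ji; apply: he; apply: leq_trans ji im.
rewrite -(sqr_sqrtc z) -!nodal_double //; apply: h3.
  by rewrite ltnS leq_double.
by rewrite -(@expr_le1 _ 2) ?normc_ge0 // -normcX sqr_sqrtc.
Qed.

(** Even [n] reduces to the squares at [n./2], hence the induction over all [k] and [e]. For n = 2i
    + 1 the nodal polynomial is an even function, maximal in modulus at [e i.*2] and at its
    antipode, times [z - e i.*2], whose modulus reaches 2 only at the antipode. *)
Lemma leja_seqP (R : rcfType) n (k : nat) (e : nat -> R[i]) :
  leja_seq k e -> (n < k)%N ->
  [/\ normc (e n) = 1, nodal e n (e n) != 0 & odd n -> e n = - e n.-1].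
Proof.
elim/ltn_ind: n k e => n IH k e he nk.
have pairs m : (m.*2 <= n)%N -> antipodal m e.
  move=> mn i im.
  have i2 : (i.*2.+1 < n)%N.
    by apply: leq_trans mn; rewrite -doubleS leq_double.
  by case: (IH _ i2 _ _ he (ltn_trans i2 nk)) => _ _ -> //=; rewrite odd_double.
have [h1 h2 h3] := he.
case: (posnP n) => [n0|n_gt0].
  by rewrite n0 /nodal big_ord0 oner_neq0 h2 //; apply: leq_ltn_trans nk.
case: (boolP (odd n)) => on; last first.
  have en : n = (n./2).*2 by rewrite -{1}(odd_double_half n) (negbTE on).
  have pn : antipodal n./2 e by apply: pairs; rewrite -en.
  have hn : (n./2 < n)%N by rewrite -divn2 ltn_Pdiv.
  have hf : leja_seq n./2.+1 (even_squares e).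
    by apply: leja_even_squares => //; apply: leja_seq_le he; rewrite -en.
  case: (IH _ hn _ _ hf (ltnSn _)) => /eqP.
  by rewrite {1 3}/even_squares normc_sqr_eq1 -nodal_double // -en => /eqP.
set i := n./2; have en : n = i.*2.+1.
  by rewrite -{1}(odd_double_half n) on.
have i2n : (i.*2 < n)%N by rewrite en.
have i2k := ltn_trans i2n nk.
case: (IH _ i2n _ _ he i2k) => x1 w0 _.
have pn : antipodal i e by apply: pairs; rewrite ltnW.
have wN : nodal e i.*2 (- e i.*2) = nodal e i.*2 (e i.*2).
  by rewrite !nodal_double // sqrrN.
have nodn z : nodal e n z = nodal e i.*2 z * (z - e i.*2).
  by rewrite en nodalS.
have nx1 : normc (- e i.*2) <= 1 by rewrite normcN x1.
have y1 := h1 _ nk.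
have wgt0 : 0 < normc (nodal e i.*2 (e i.*2)).
  by rewrite lt_def normc_ge0 normc_eq0 w0.
(* Comparison with the value at [- e i.*2] forces the distance from [e n] to [e i.*2] to be at least
   2. *)
have yE : e n = - e i.*2.
  apply: antipode_normc => //.
  rewrite -(ler_pM2l wgt0).
  have := h3 _ nk _ nx1; rewrite !nodn !Normc.normcM wN.
  rewrite -opprD normcN -mulr2n normcMn x1 => /le_trans -> //.
  by rewrite ler_wpM2r ?normc_ge0 ?h3.
split=> //; first by rewrite yE normcN x1.
  rewrite nodn yE wN mulf_neq0 // -opprD oppr_eq0 -mulr2n.
  by rewrite -normc_eq0 normcMn x1 pnatr_eq0.
by rewrite yE en.
Qed.

(** * Fundamental polynomials and their kernel *)

Definition lagrange (R : rcfType) (e : nat -> R[i]) (m j : nat) (z : R[i]) :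
    R[i] :=
  \prod_(i < m | i != j :> nat) ((z - e i) / (e j - e i)).

(** For distinct nodes, the reproducing kernel of the polynomials of degree less than [m] under the
    scalar product summed over the nodes. *)
Definition lagrange_dot (R : rcfType) (e : nat -> R[i]) (m : nat)
    (z w : R[i]) : R[i] :=
  \sum_(j < m) lagrange e m j z * (lagrange e m j w)^*.

Definition quad_lebesgue (R : rcfType) (e : nat -> R[i]) (m : nat)
    (z : R[i]) : R :=
  \sum_(j < m) normc (lagrange e m j z) ^+ 2.

Lemma mulc_conj (R : rcfType) (z : R[i]) : z * z^* = (normc z ^+ 2)%:C.
Proof.
rewrite sqr_normcE; case: z => a b; apply/eqP; rewrite eq_complex /=.
by apply/andP; split; apply/eqP; ring.
Qed.

Lemma conjc_unit (R : rcfType) (z : R[i]) : normc z = 1 -> z^* = z^-1.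
Proof.
move=> z1; have z0 : z != 0 by rewrite -normc_eq0 z1 oner_eq0.
by apply: (mulfI z0); rewrite mulc_conj z1 expr1n divff.
Qed.

Lemma lagrange_dot_diag (R : rcfType) (e : nat -> R[i]) m z :
  lagrange_dot e m z z = (quad_lebesgue e m z)%:C.
Proof. by rewrite rmorph_sum; apply: eq_bigr => j _; rewrite mulc_conj. Qed.

Lemma nodal_neq (R : rcfType) (e : nat -> R[i]) m j :
  nodal e m (e m) != 0 -> (j < m)%N -> e m - e j != 0.
Proof.
by move=> h jm; move/prodf_neq0: h => /(_ (Ordinal jm) isT).
Qed.

Lemma lagrange_last (R : rcfType) (e : nat -> R[i]) m z :
  lagrange e m.+1 m z = nodal e m z / nodal e m (e m).
Proof.
rewrite /lagrange big_mkcond big_ord_recr /= eqxx mulr1 /nodal -prodf_div.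
by apply: eq_bigr => i _; rewrite neq_ltn ltn_ord.
Qed.

(** Subtracting its value at [e m] times the new fundamental polynomial makes the old one vanish at
    [e m] without changing it at the old nodes. *)
Lemma lagrange_rec (R : rcfType) (e : nat -> R[i]) m j z :
  nodal e m (e m) != 0 -> (j < m)%N ->
  lagrange e m.+1 j z =
  lagrange e m j z - nodal e m z / nodal e m (e m) * lagrange e m j (e m).
Proof.
move=> w0 jm; have emj := nodal_neq w0 jm.
have nodalD u : nodal e m u =
    (u - e j) * \prod_(i < m | i != j :> nat) (u - e i).
  by rewrite /nodal (bigD1 (Ordinal jm)).
have -> : lagrange e m.+1 j z =
    lagrange e m j z * ((z - e m) / (e j - e m)).
  rewrite /lagrange big_mkcond big_ord_recr /= -big_mkcond /=.
  by rewrite neq_ltn jm orbT.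
move: w0; rewrite /lagrange !prodf_div !nodalD mulf_eq0 negb_or => /andP[_].
move: (\prod_(i < m | i != j :> nat) (e m - e i)) => u.
(* Generalized together with its inverse, so that [field] does not ask for this product to be
   nonzero. *)
move: (\prod_(i < m | i != j :> nat) (e j - e i))^-1 => v.
move: (\prod_(i < m | i != j :> nat) (z - e i)) => w u0.
field; rewrite u0 emj /=.
by rewrite -opprB oppr_eq0.
Qed.

(** * Doubling: passage to the squares of the nodes *)

Lemma big_ord_double (R : Type) (idx : R) (op : Monoid.law idx) m
    (F : nat -> R) :
  \big[op/idx]_(i < m.*2) F i = \big[op/idx]_(i < m) op (F i.*2) (F i.*2.+1).
Proof.
elim: m => [|m IH]; first by rewrite !big_ord0.
by rewrite doubleS !big_ord_recr /= IH Monoid.mulmA.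
Qed.

(** Each pair other than j gives a quotient of differences of squares; from the pair j only the node
    [- e j.*2] remains. *)
Lemma lagrange_double (R : rcfType) (e : nat -> R[i]) m j z :
  antipodal m e -> (j < m)%N ->
  lagrange e m.*2 j.*2 z =
    lagrange (even_squares e) m j (z ^+ 2) *
      ((z + e j.*2) / (e j.*2 + e j.*2)).
Proof.
move=> he jm; rewrite /lagrange big_mkcond.
rewrite (big_ord_double _ _
  (fun i => if i != j.*2 then (z - e i) / (e j.*2 - e i) else 1)).
rewrite (bigD1 (Ordinal jm)) //= mulrC; congr (_ * _).
  apply: eq_big => // i ij; have {}ij : i != j :> nat by [].
  rewrite (inj_eq double_inj) ij.
  have -> : i.*2.+1 != j.*2.
    by apply/eqP => /(congr1 odd) /=; rewrite !odd_double.
  rewrite he // mulf_div /even_squares.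
  by congr (_ / _); ring.
rewrite eqxx mul1r.
have -> : j.*2.+1 != j.*2 by rewrite neq_ltn ltnSn orbT.
by rewrite he // !opprK.
Qed.

Lemma lagrange_doubleS (R : rcfType) (e : nat -> R[i]) m j z :
  antipodal m e -> (j < m)%N ->
  lagrange e m.*2 j.*2.+1 z =
    lagrange (even_squares e) m j (z ^+ 2) *
      ((e j.*2 - z) / (e j.*2 + e j.*2)).
Proof.
move=> he jm; rewrite /lagrange big_mkcond.
rewrite (big_ord_double _ _
  (fun i => if i != j.*2.+1 then (z - e i) / (e j.*2.+1 - e i) else 1)).
rewrite (bigD1 (Ordinal jm)) //= mulrC; congr (_ * _).
  apply: eq_big => // i ij; have {}ij : i != j :> nat by [].
  rewrite eqSS (inj_eq double_inj) ij.
  have -> : i.*2 != j.*2.+1.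
    by apply/eqP => /(congr1 odd) /=; rewrite !odd_double.
  rewrite !he // mulf_div /even_squares.
  by congr (_ / _); ring.
rewrite eqxx mulr1.
have -> : j.*2 != j.*2.+1 by rewrite neq_ltn ltnSn.
by rewrite he // -opprB -opprD invrN mulrNN.
Qed.

(** In the two terms of a pair the mixed products cancel; since the nodes have modulus 1, the
    remaining weight does not depend on j. *)
Lemma lagrange_dot_double (R : rcfType) (e : nat -> R[i]) m z w :
  antipodal m e -> (forall i, (i < m)%N -> normc (e i.*2) = 1) ->
  lagrange_dot e m.*2 z w =
    lagrange_dot (even_squares e) m (z ^+ 2) (w ^+ 2) * ((1 + z * w^*) / 2).
Proof.
move=> he e1; rewrite /lagrange_dot mulr_suml.
rewrite (big_ord_double _ _
  (fun i => lagrange e m.*2 i z * (lagrange e m.*2 i w)^*)).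
apply: eq_bigr => j _ /=.
rewrite !lagrange_double ?lagrange_doubleS // !rmorphM /= !fmorphV.
rewrite !rmorphD !rmorphN /= (conjc_unit (e1 _ (ltn_ord j))).
have e0 : e j.*2 != 0 by rewrite -normc_eq0 e1 // oner_eq0.
field; rewrite e0 /=.
by rewrite -mulr2n -mulr_natl mulf_neq0 // pnatr_eq0.
Qed.

Lemma quad_lebesgue_double (R : rcfType) (e : nat -> R[i]) m z :
  antipodal m e -> (forall i, (i < m)%N -> normc (e i.*2) = 1) ->
  normc z = 1 ->
  quad_lebesgue e m.*2 z = quad_lebesgue (even_squares e) m (z ^+ 2).
Proof.
move=> he e1 z1; apply: (@complexI R).
rewrite -!lagrange_dot_diag lagrange_dot_double // mulc_conj z1 expr1n.
by rewrite -mulr2n divff ?mulr1 // pnatr_eq0.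
Qed.

(** * Effect of one more node on the quadratic function *)

Lemma sqr_normcB (R : rcfType) (a b c : R[i]) :
  normc (a - c * b) ^+ 2 =
  normc a ^+ 2 + normc c ^+ 2 * normc b ^+ 2 - 2 * Re (c^* * (a * b^*)).
Proof. by rewrite !sqr_normcE; case: a b c => ? ? [? ?] [? ?] /=; ring. Qed.

Lemma quad_lebesgue_rec (R : rcfType) (e : nat -> R[i]) m z :
  nodal e m (e m) != 0 ->
  let c := nodal e m z / nodal e m (e m) in
  quad_lebesgue e m.+1 z =
  quad_lebesgue e m z + normc c ^+ 2 * (quad_lebesgue e m (e m) + 1) -
    2 * Re (c^* * lagrange_dot e m z (e m)).
Proof.
move=> w0 c; rewrite {1}/quad_lebesgue big_ord_recr /= lagrange_last -/c.
under eq_bigr => j _ do rewrite lagrange_rec // -/c sqr_normcB.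
rewrite !big_split /= sumrN -!mulr_sumr.
have -> : \sum_(i < m) Re (c^* * (lagrange e m i z * (lagrange e m i (e m))^*))
    = Re (c^* * lagrange_dot e m z (e m)).
  by rewrite mulr_sumr (raddf_sum (@complex.Re R : Rcomplex R -> R)).
rewrite -!/(quad_lebesgue _ _ _).
ring.
Qed.

(** On the circle conjugation is inversion, which multiplies each of the m - 1 factors by
    [e j / z]. *)
Lemma conjc_lagrange (R : rcfType) (e : nat -> R[i]) m j z :
  (forall i, (i < m)%N -> normc (e i) = 1) -> normc z = 1 -> (j < m)%N ->
  (lagrange e m j z)^* = lagrange e m j z * (e j / z) ^+ m.-1.
Proof.
move=> e1 z1 jm.
have -> : (e j / z) ^+ m.-1 = \prod_(i < m | i != j :> nat) (e j / z).
  by rewrite prodr_const (@cardC1 _ (Ordinal jm)) card_ord.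
rewrite /lagrange rmorph_prod -big_split /=; apply: eq_bigr => i _.
have n0 (u : R[i]) : normc u = 1 -> u != 0.
  by rewrite -normc_eq0 => ->; rewrite oner_eq0.
rewrite rmorphM fmorphV !rmorphB /= !conjc_unit ?e1 //.
(* If the nodes coincide, the factor is a division by 0, so both sides are 0. *)
have [->|ne] := eqVneq (e j) (e i).
  by rewrite !subrr !invr0 !mulr0 mul0r.
have neV : e i != e j by rewrite eq_sym.
by field; apply/and5P; split; rewrite ?mulN1r ?subr_eq0 ?n0 ?e1.
Qed.

Lemma conjc_nodal (R : rcfType) (e : nat -> R[i]) m z w :
  (forall i, (i < m)%N -> normc (e i) = 1) -> normc z = 1 -> normc w = 1 ->
  nodal e m w != 0 ->
  (nodal e m z / nodal e m w)^* = nodal e m z / nodal e m w * (w / z) ^+ m.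
Proof.
move=> e1 z1 w1 w0.
have n0 (u : R[i]) : normc u = 1 -> u != 0.
  by rewrite -normc_eq0 => ->; rewrite oner_eq0.
have cn u : normc u = 1 -> (nodal e m u)^* =
    nodal e m u * (\prod_(i < m) (- (e i)^-1) * (u ^- m)).
  move=> u1; rewrite -(card_ord m) -exprVn -prodr_const card_ord.
  rewrite /nodal rmorph_prod -!big_split; apply: eq_bigr => i _ /=.
  rewrite rmorphB /= !conjc_unit ?e1 //.
  by field; rewrite !n0 ?e1.
rewrite rmorphM fmorphV /= !cn // expr_div_n.
have p0 : \prod_(i < m) (- (e i)^-1) != 0.
  by apply/prodf_neq0 => i _; rewrite oppr_eq0 invr_eq0 n0 ?e1.
by field; rewrite w0 p0 !expf_neq0 ?n0.
Qed.

Lemma lagrange_dot_AMGM (R : rcfType) (e : nat -> R[i]) m z w :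
  normc (lagrange_dot e m z w) <=
  (quad_lebesgue e m z + quad_lebesgue e m w) / 2.
Proof.
apply: le_trans (le_normc_sum _ _) _.
rewrite /quad_lebesgue -big_split mulr_suml; apply: ler_sum => j _ /=.
rewrite Normc.normcM.
have -> : normc (lagrange e m j w)^* = normc (lagrange e m j w).
  by case: (lagrange e m j w) => a b /=; rewrite sqrrN.
have := sqr_ge0 (normc (lagrange e m j z) - normc (lagrange e m j w)); lra.
Qed.

(** In every term the powers of [e j] agree on both sides and leave [z / w]. Thus [X] is real up to
    a rotation by a square root of [z / w]. *)
Lemma conjc_lagrange_dot (R : rcfType) (e : nat -> R[i]) m z w :
  (forall i, (i < m)%N -> normc (e i) = 1) -> normc z = 1 -> normc w = 1 ->
  nodal e m w != 0 ->
  let X := (nodal e m z / nodal e m w)^* * lagrange_dot e m z w in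
  X^* = X * (z / w).
Proof.
move=> e1 z1 w1 w0 X; rewrite {}/X.
rewrite /lagrange_dot mulr_sumr mulr_suml rmorph_sum; apply: eq_bigr => j _.
have jm := ltn_ord j.
have n0 (u : R[i]) : normc u = 1 -> u != 0.
  by rewrite -normc_eq0 => ->; rewrite oner_eq0.
have cc := conjc_nodal e1 z1 w1 w0.
rewrite !rmorphM /= in cc *; rewrite !conjcK cc !conjc_lagrange //.
have -> : (w / z) ^+ m = (w / z) ^+ m.-1 * (w / z).
  by rewrite -exprSr prednK // (leq_ltn_trans _ jm).
rewrite !expr_div_n.
by field; rewrite w0 !expf_neq0 ?n0 ?e1.
Qed.

(* The kernel at [z ^ 2, e_2m ^ 2], rotated by [z / e_2m], is real. Its value
   [x] enters both sections, with opposite behaviour in [Re (z / e_2m)]. *)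
Lemma quad_lebesgue_doubleS (R : rcfType) (e : nat -> R[i]) m z :
  antipodal m e -> (forall i, (i <= m)%N -> normc (e i.*2) = 1) ->
  nodal e m.*2 (e m.*2) != 0 -> normc z = 1 ->
  let f := even_squares e in
  let a := quad_lebesgue f m (z ^+ 2) in
  let b := quad_lebesgue f m (f m) in
  let g := normc (nodal f m (z ^+ 2) / nodal f m (f m)) in
  let t := Re (z / e m.*2) in
  exists x,
    [/\ quad_lebesgue e m.*2.+1 z = a + g ^+ 2 * (b + 1) - x * (1 + t),
        quad_lebesgue f m.+1 (z ^+ 2) = a + g ^+ 2 * (b + 1) - 2 * x * t
      & `|x| <= g * ((a + b) / 2)].
Proof.
move=> he e1 w0 z1 f a b g t.
have em1 : normc (e m.*2) = 1 by apply: e1.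
have e1' i : (i < m)%N -> normc (e i.*2) = 1 by move=> im; apply/e1/ltnW.
have f1 i : (i < m)%N -> normc (f i) = 1.
  by move=> im; rewrite normcX e1' // expr1n.
have fm1 : normc (f m) = 1 by rewrite normcX em1 expr1n.
have Z1 : normc (z ^+ 2) = 1 by rewrite normcX z1 expr1n.
have w0' : nodal f m (f m) != 0 by rewrite /f -nodal_double.
pose zt := z / e m.*2.
have zt1 : normc zt = 1 by rewrite Normc.normcM Normc.normcV z1 em1 invr1 mulr1.
have zt0 : zt != 0 by rewrite -normc_eq0 zt1 oner_eq0.
pose c := nodal f m (z ^+ 2) / nodal f m (f m).
pose X := c^* * lagrange_dot f m (z ^+ 2) (f m).
have XE : X^* = X * zt ^+ 2.
  by rewrite /X conjc_lagrange_dot // /zt expr_div_n.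
have Xr : (X * zt)^* = X * zt.
  by rewrite rmorphM /= XE conjc_unit // expr2 mulrA mulfK.
pose x := Re (X * zt).
have xE : X * zt = x%:C.
  rewrite /x; move: Xr; case: (X * zt) => u v [] /= hv.
  by congr (_ +i* _); lra.
have XxE : X = x%:C * zt^* by rewrite conjc_unit // -xE mulfK.
have ReX : Re X = x * t.
  rewrite XxE /t -/zt; case: (zt) => u v /=; ring.
exists x; split.
- rewrite quad_lebesgue_rec // !quad_lebesgue_double // !nodal_double // -/c.
  rewrite lagrange_dot_double // -/a -/b -/g -/f conjc_unit //.
  have -> : c^* * (lagrange_dot f m (z ^+ 2) (e m.*2 ^+ 2) *
      ((1 + z / e m.*2) / 2)) = (X + x%:C) / 2.
    rewrite -xE /X /zt /f /even_squares.
    by field; rewrite -normc_eq0 em1 oner_eq0.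
  have -> : Re ((X + x%:C) / 2) = (x * t + x) / 2.
    rewrite -ReX; case: (X) => u v.
    have -> : (2 : R[i])^-1 = (2^-1 : R)%:C by rewrite fmorphV rmorph_nat.
    by rewrite /=; ring.
  by field.
- by rewrite quad_lebesgue_rec // -/c -/X ReX mulrA.
have -> : `|x| = normc X.
  rewrite -[RHS]mulr1 -zt1 -Normc.normcM xE /= expr0n addr0 sqrtr_sqr //.
rewrite Normc.normcM.
have -> : normc c^* = normc c by case: (c) => u v /=; rewrite sqrrN.
by apply: ler_wpM2l (lagrange_dot_AMGM _ _ _ _); rewrite normc_ge0.
Qed.

(** * Size of the nodal ratio *)

(** Factoring out [z * w] leaves [u] plus its conjugate, twice a real part. *)
Lemma normc_sqrD_unit (R : rcfType) (z w : R[i]) :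
  normc z = 1 -> normc w = 1 -> normc (z ^+ 2 + w ^+ 2) / 2 = `|Re (z / w)|.
Proof.
move=> z1 w1; set u := z / w.
have n0 (y : R[i]) : normc y = 1 -> y != 0.
  by rewrite -normc_eq0 => ->; rewrite oner_eq0.
have u1 : normc u = 1 by rewrite Normc.normcM Normc.normcV z1 w1 invr1 mulr1.
have -> : z ^+ 2 + w ^+ 2 = z * w * (u + u^*).
  by rewrite conjc_unit // /u; field; rewrite !n0.
rewrite !Normc.normcM z1 w1 !mul1r.
case: (u) => a b /=; rewrite subrr expr0n addr0 sqrtr_sqr -mulr2n normrMn.
by rewrite -[_ *+ 2]mulr_natr mulfK // pnatr_eq0.
Qed.

Lemma leja_antipodal (R : rcfType) m k (e : nat -> R[i]) :
  leja_seq k e -> (m.*2 <= k)%N -> antipodal m e.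
Proof.
move=> he mk i im.
have ik : (i.*2.+1 < k)%N by apply: leq_trans mk; rewrite -doubleS leq_double.
by have [_ _ ->] := leja_seqP he ik; rewrite //= odd_double.
Qed.

Lemma leja_nodal_ratio (R : rcfType) m (e : nat -> R[i]) z :
  leja_seq m.+1 e -> normc z <= 1 ->
  normc (nodal e m z / nodal e m (e m)) <= 1.
Proof.
move=> he z1; have [_ w0 _] := leja_seqP he (ltnSn m).
rewrite Normc.normcM Normc.normcV ler_pdivrMr ?mul1r.
  by case: he => _ _; apply.
by rewrite lt_def normc_ge0 normc_eq0 w0.
Qed.

(** The last node is the antipode of [e n.*2], and [nodal e n.*2] is even. Its ratio is at most 1,
    which leaves that of the factor [z - e n.*2], of modulus 2 at the last node. *)
Lemma leja_nodal_ratio_odd (R : rcfType) n (e : nat -> R[i]) z :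
  leja_seq n.*2.+2 e -> normc z <= 1 ->
  normc (nodal e n.*2.+1 z / nodal e n.*2.+1 (e n.*2.+1)) <=
  normc (z + e n.*2.+1) / 2.
Proof.
move=> he z1.
have he1 : leja_seq n.*2.+1 e by apply: leja_seq_le he.
have ap : antipodal n.+1 e by apply: (leja_antipodal he).
have [e1 _ _] := leja_seqP he1 (ltnSn _).
rewrite ap // !nodalS (_ : nodal e n.*2 (- _) = nodal e n.*2 (e n.*2)).
  rewrite -mulf_div Normc.normcM.
  have -> : normc ((z - e n.*2) / (- e n.*2 - e n.*2)) =
      normc (z - e n.*2) / 2.
    rewrite Normc.normcM Normc.normcV -opprD normcN -mulr2n normcMn e1 //.
  rewrite ler_piMl ?divr_ge0 ?normc_ge0 //.
  exact: leja_nodal_ratio.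
have ap' : antipodal n e by move=> i im; apply/ap/ltnW.
by rewrite !nodal_double ?sqrrN.
Qed.

(** * Real inequalities for length 2n + 1 *)

(** Only a negative [x] is harmful: for [t >= 0] the last hypothesis compensates it, for [t < 0] the
    bound [g <= - t] does. *)
Lemma odd_step_bound (R : realFieldType) (n a b g t x : R) :
  0 <= n -> 0 <= g -> a <= n -> b <= n -> `|x| <= g * ((a + b) / 2) ->
  g <= `|t| -> `|t| <= 1 ->
  a + g ^+ 2 * (b + 1) - 2 * x * t <= (n + 1) / 2 ->
  a + g ^+ 2 * (b + 1) - x * (1 + t) <= 2 * n + 1.
Proof.
move=> n0 g0 an bn xle gt t1 h.
have g1 : g <= 1 by apply: le_trans t1.
have xg : `|x| <= g * n by apply: le_trans xle _; apply: ler_wpM2l => //; lra.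
have [x0|x0] := leP 0 x.
  have : 0 <= x * (1 + t).
    by apply: mulr_ge0 => //; move: t1; rewrite ler_norml; lra.
  have : g ^+ 2 * (b + 1) <= n + 1.
    apply: le_trans (_ : g ^+ 2 * (n + 1) <= _).
      by apply: ler_wpM2l; rewrite ?sqr_ge0 //; lra.
    by apply: ler_piMl; rewrite ?expr_le1 //; lra.
  lra.
rewrite (ltr0_norm x0) in xg.
(* If [t >= 0], [h] bounds the left side by (n + 1) / 2 + x t - x, where - x <= n. *)
have [t0|t0] := leP 0 t.
  have : g * n <= n by apply: ler_piMl.
  have : x * t <= 0 by rewrite mulr_le0_ge0 // ltW.
  lra.
(* The bounds below add up to n + t^2 (n + 1) - t n (1 + t) = n + t^2 - t n. *)
rewrite (ltr0_norm t0) in gt t1.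
have t2 : g ^+ 2 <= t ^+ 2 by rewrite -(sqrrN t) lerXn2r ?nnegrE //; lra.
have h1 : g ^+ 2 * (b + 1) <= t ^+ 2 * (n + 1).
  apply: le_trans (_ : g ^+ 2 * (n + 1) <= _).
    by apply: ler_wpM2l; rewrite ?sqr_ge0 //; lra.
  by apply: ler_wpM2r => //; lra.
have h2 : - x * (1 + t) <= (- t * n) * (1 + t).
  apply: ler_wpM2r; first by lra.
  by apply: le_trans xg _; apply: ler_wpM2r.
have : t ^+ 2 <= 1 by rewrite -(sqrrN t) expr_le1 //; lra.
have : - t * n <= n by apply: ler_piMl => //; lra.
move: h1 h2; lra.
Qed.

(** The three terms are at most n / 2, n / 2 + 1 and n, as |x| <= n / 2 and 1 + t <= 2. *)
Lemma even_step_bound (R : realFieldType) (n a b g t x : R) :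
  0 <= n -> 0 <= g -> g <= 1 -> a * 2 <= n -> b * 2 <= n ->
  `|x| <= g * ((a + b) / 2) -> `|t| <= 1 ->
  a + g ^+ 2 * (b + 1) - x * (1 + t) <= 2 * n + 1.
Proof.
move=> n0 g0 g1 an bn xle; rewrite ler_norml => t1.
have xn : - x <= n / 2.
  apply: le_trans (_ : `|x| <= _); first by rewrite -normrN ler_norm.
  apply: le_trans xle _; apply: le_trans (_ : g * (n / 2) <= _).
    by apply: ler_wpM2l => //; lra.
  by apply: ler_piMl => //; lra.
have : g ^+ 2 * (b + 1) <= n / 2 + 1.
  apply: le_trans (_ : g ^+ 2 * (n / 2 + 1) <= _).
    by apply: ler_wpM2l; rewrite ?sqr_ge0 //; lra.
  by apply: ler_piMl; rewrite ?expr_le1 //; lra.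
have : - x * (1 + t) <= (n / 2) * (1 + t) by apply: ler_wpM2r => //; lra.
have : (n / 2) * (1 + t) <= (n / 2) * 2 by apply: ler_wpM2l; lra.
lra.
Qed.

(** * The quadratic bound on the circle *)

(** Strong induction on [k] with [v] free: for k = 2m + 1 it is called with [v = 1] at the even one
    of m and m + 1, and with [v = 0] at m when m is odd. *)
Lemma quad_lebesgue_le (R : rcfType) k (e : nat -> R[i]) v z :
  leja_seq k e -> (0 < k)%N -> (2 ^ v %| k)%N -> normc z = 1 ->
  quad_lebesgue e k z * 2 ^+ v <= k%:R.
Proof.
elim/ltn_ind: k e v z => k IH e v z he k0 vk z1.
have e1 n : (n < k)%N -> normc (e n) = 1.
  by move=> nk; case: (leja_seqP he nk).
have ek := odd_double_half k; set m := k./2 in ek.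
have ap : antipodal m e by apply: (leja_antipodal he); rewrite -ek leq_addl.
have Z1 : normc (z ^+ 2) = 1 by rewrite normcX z1 expr1n.
case: (boolP (odd k)) ek => [ok|_]; last first.
  rewrite add0n => ek.
  have m0 : (0 < m)%N by rewrite -double_gt0 ek.
  have mk : (m < k)%N by rewrite -ek -addnn -{1}(addn0 m) ltn_add2l.
  have hf : leja_seq m (even_squares e).
    rewrite -(prednK m0); apply: leja_even_squares.
      by apply: leja_seq_le he; rewrite -ek -{2}(prednK m0) doubleS.
    by move=> i im; apply: ap; apply: leq_trans im (leq_pred _).
  have e1' i : (i < m)%N -> normc (e i.*2) = 1.
    by move=> im; rewrite e1 // -ek ltn_double.
  rewrite -ek quad_lebesgue_double //.
  have q0 : 0 <= quad_lebesgue (even_squares e) m (z ^+ 2).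
    by apply: sumr_ge0 => i _; rewrite sqr_ge0.
  rewrite -muln2 natrM; case: v vk => [|v] vk.
    by have := IH _ mk _ 0 _ hf m0 (dvd1n _) Z1; lra.
  rewrite (exprSr 2 v) mulrA ler_pM2r ?ltr0n //; apply: IH => //.
  by move: vk; rewrite -ek -muln2 expnSr dvdn_pmul2r.
rewrite add1n => ek.
have -> : v = 0%N.
  case: v vk => // v vk; move: ok; rewrite -[odd k]negbK -dvdn2.
  by rewrite (dvdn_trans _ vk) // expnS dvdn_mulr.
rewrite expr0 mulr1.
(* For k = 1 the only fundamental polynomial is an empty product. If m > 0, then m + 1 < k, so the
   induction also covers f_0, ..., f_m. *)
have [m0|m0] := posnP m.
  rewrite -ek m0 /quad_lebesgue big_ord_recl big_ord0 addr0 /lagrange.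
  by rewrite big_pred0 ?Normc.normc1 ?expr1n // => -[[]].
set f := even_squares e.
have hf : leja_seq m.+1 f by apply: leja_even_squares; rewrite ?ek.
have hfm : leja_seq m f by apply: leja_seq_le hf.
have mk : (m < k)%N by rewrite -ek ltnS -addnn leq_addr.
have m1k : (m.+1 < k)%N by rewrite -ek ltnS -addnn -{1}(addn0 m) ltn_add2l.
have m2k : (m.*2 < k)%N by rewrite -ek.
have [em1 w0 _] := leja_seqP he m2k.
have fm1 : normc (f m) = 1 by rewrite normcX em1 expr1n.
have e1' i : (i <= m)%N -> normc (e i.*2) = 1.
  by move=> im; rewrite e1 // -ek ltnS leq_double.
have [x []] := quad_lebesgue_doubleS ap e1' w0 z1.
rewrite ek -/f; set a := quad_lebesgue f m _; set b := quad_lebesgue f m _.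
set g := normc _; set t := complex.Re _ => -> h hx.
have tle : `|t| <= 1.
  rewrite -ler_sqr ?nnegrE ?ler01 // real_normK ?num_real //.
  have : normc (z / e m.*2) ^+ 2 = 1.
    by rewrite Normc.normcM Normc.normcV z1 em1 invr1 mulr1 expr1n.
  by rewrite sqr_normcE -/t expr1n => <-; rewrite lerDl sqr_ge0.
have g0 : 0 <= g by apply: normc_ge0.
have -> : k%:R = 2 * m%:R + 1 :> R.
  by rewrite -ek -addn1 natrD -muln2 natrM mulrC.
have [om|em] := boolP (odd m).
  have am := IH _ mk _ 0%N _ hfm m0 (dvd1n _) Z1.
  have bm := IH _ mk _ 0%N _ hfm m0 (dvd1n _) fm1.
  rewrite !mulr1 -/a -/b in am bm.
  have dm : (2 ^ 1 %| m.+1)%N by rewrite dvdn2 /= om.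
  have := IH _ m1k _ 1%N _ hf isT dm Z1.
  rewrite h => qm; apply: (odd_step_bound (g := g)) => //; last first.
    by move: qm; rewrite -[m.+1]addn1 natrD; lra.
  (* What remains is [g <= |t|]: as [m] is odd, the last node [f m] is an antipode. *)
  rewrite -normc_sqrD_unit // -[e m.*2 ^+ 2]/(f m) /g.
  have mE : m = (m./2).*2.+1 by rewrite -{1}(odd_double_half m) om.
  rewrite mE; apply: leja_nodal_ratio_odd; last by rewrite Z1.
  by rewrite -mE.
have dm : (2 ^ 1 %| m)%N by rewrite dvdn2.
have am := IH _ mk _ 1%N _ hfm m0 dm Z1.
have bm := IH _ mk _ 1%N _ hfm m0 dm fm1.
apply: (even_step_bound (g := g)) => //.
by apply: leja_nodal_ratio; rewrite ?Z1.
Qed.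

(** * From the circle to the disk *)

(* On the circle, [p.[z] = g.[z ^+ 2] + h.[z ^+ 2] * z] with [g] and [h] the
   even and odd parts; averaging over [z] and [- z] passes the bound on. *)
Lemma coef_le_circle (R : rcfType) (p : {poly R[i]}) B i :
  (forall z, normc z = 1 -> normc p.[z] <= B) -> normc p`_i <= B.
Proof.
have [n] := ubnP (size p); elim: n p i => // n IH p i; rewrite ltnS => pn pB.
have B0 : 0 <= B by apply: le_trans (normc_ge0 _) (pB 1 (Normc.normc1 R)).
have [p1|p1] := leqP (size p) 1.
  case: i => [|i].
    by have := pB 1 (Normc.normc1 R); rewrite {1}(size1_polyC p1) hornerC.
  by rewrite nth_default ?Normc.normc0 // (leq_trans p1).
have pE z : p.[z] = (even_poly p).[z ^+ 2] + (odd_poly p).[z ^+ 2] * z.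
  by rewrite -{1}(poly_even_odd p) !hornerE !horner_comp !hornerE.
have n2 : normc (2^-1 : R[i]) = 2^-1.
  by rewrite Normc.normcV (normcMn 1 2) Normc.normc1.
have bounds Z : normc Z = 1 ->
    normc (even_poly p).[Z] <= B /\ normc (odd_poly p).[Z] <= B.
  move=> Z1; pose z := sqrtc Z.
  have z1 : normc z = 1.
    by apply/eqP; rewrite -normc_sqr_eq1 sqr_sqrtc Z1.
  have Nz1 : normc (- z) = 1 by rewrite normcN.
  have := le_normcD p.[z] p.[- z]; have := le_normcD p.[z] (- p.[- z]).
  rewrite normcN !pE sqrrN sqr_sqrtc => h1 h2.
  have := pB _ z1; have := pB _ Nz1; rewrite !pE sqrrN sqr_sqrtc => h3 h4.
  move: (even_poly p).[Z] (odd_poly p).[Z] h1 h2 h3 h4 => g h h1 h2 h3 h4.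
  have gE : g = (g + h * z + (g + h * - z)) * 2^-1 by field.
  have hE : h * z = (g + h * z - (g + h * - z)) * 2^-1 by field.
  split; first by rewrite gE Normc.normcM n2; lra.
  by rewrite -[normc h]mulr1 -z1 -Normc.normcM hE Normc.normcM n2; lra.
have half : (uphalf (size p) < size p)%N.
  by case: (size p) p1 => [|[|s]] // _; rewrite /= ltnS uphalf_half; lia.
rewrite -(odd_double_half i); case: (odd i).
  rewrite -coef_odd_poly; apply: IH => [|Z /bounds[] //].
  apply: leq_ltn_trans (size_odd_poly _) _; apply: leq_trans pn.
  by apply: leq_ltn_trans half; rewrite uphalf_half leq_addl.
rewrite -coef_even_poly; apply: IH => [|Z /bounds[] //].
by apply: leq_ltn_trans (size_even_poly _) _; apply: leq_trans pn.
Qed.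

(** If x > B > 0, Bernoulli's inequality makes [(x / B) ^+ n] exceed any [C]. *)
Lemma le_of_exp_le (R : archiRealFieldType) (x B C : R) :
  0 <= B -> (forall n, x ^+ n <= C * B ^+ n) -> x <= B.
Proof.
move=> B0 h; rewrite leNgt; apply/negP => Bx.
have [Bz|Bp] := eqVneq B 0.
  by have := h 1%N; rewrite Bz expr0n mulr0 expr1 leNgt -Bz Bx.
have {Bp}B0 : 0 < B by rewrite lt_def Bp.
pose d := x / B - 1.
have d0 : 0 < d by rewrite subr_gt0 ltr_pdivlMr ?mul1r.
have bern n : 1 + n%:R * d <= (x / B) ^+ n.
  elim: n => [|n IHn]; first by rewrite mul0r addr0 expr0.
  have dE : x / B = 1 + d by rewrite /d addrC subrK.
  have : (1 + n%:R * d) * (1 + d) <= (1 + d) ^+ n.+1.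
    rewrite exprSr; apply: ler_wpM2r; first by rewrite addr_ge0 ?ler01 ?ltW.
    by rewrite -dE.
  rewrite dE; apply: le_trans; rewrite -[n.+1]addn1 natrD.
  have : 0 <= n%:R * d * d by rewrite !mulr_ge0 ?ler0n // ltW.
  lra.
have C0 : 0 <= C by have := h 0%N; rewrite !expr0 mulr1; lra.
have [n hn] : exists n : nat, C / d < n%:R.
  by exists (Num.bound (C / d)); rewrite archi_boundP // divr_ge0 // ltW.
have := h n; rewrite -ler_pdivrMr ?exprn_gt0 // -expr_div_n.
move: hn (bern n); rewrite ltr_pdivrMr //; lra.
Qed.

(* The coefficients of [p ^+ n] are at most [B ^+ n] in modulus, so that
   [|p(z)| ^ n <= B ^ n / (1 - |z|)]; let [n] grow. *)
Lemma maximum_principle (R : realType) (p : {poly R[i]}) B z :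
  (forall z, normc z = 1 -> normc p.[z] <= B) -> normc z <= 1 ->
  normc p.[z] <= B.
Proof.
move=> pB; rewrite le_eqVlt => /orP[/eqP /pB //|z1].
have B0 : 0 <= B by apply: le_trans (normc_ge0 _) (pB 1 (Normc.normc1 R)).
apply: (@le_of_exp_le _ _ _ (1 - normc z)^-1) => // n.
rewrite -normcX -horner_exp horner_coef.
apply: le_trans (le_normc_sum _ _) _.
have cB i : normc (p ^+ n)`_i <= B ^+ n.
  apply: coef_le_circle => w w1.
  by rewrite horner_exp normcX lerXn2r ?nnegrE ?normc_ge0 ?pB.
apply: le_trans (_ : \sum_(i < size (p ^+ n)) B ^+ n * normc z ^+ i <= _).
  apply: ler_sum => i _; rewrite Normc.normcM normcX.
  by apply: ler_wpM2r => //; rewrite exprn_ge0 ?normc_ge0.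
rewrite -mulr_sumr mulrC; apply: ler_wpM2r; first exact: exprn_ge0.
(* The geometric sum times 1 - |z| is 1 - |z|^N <= 1, with N the size of [p ^+ n]. *)
rewrite -[leRHS]mul1r ler_pdivlMr ?subr_gt0 // mulrC.
rewrite -opprB mulNr -subrX1 opprB gerBl exprn_ge0 // normc_ge0 //.
Qed.

(** * The Lebesgue constant *)

(** Cauchy-Schwarz against the constant 1, from the nonnegative sum of squared deviations from the
    mean [s / n]. *)
Lemma sqr_sum_le (R : realFieldType) k (F : 'I_k -> R) :
  (\sum_(i < k) F i) ^+ 2 <= k%:R * \sum_(i < k) F i ^+ 2.
Proof.
case: k F => [|k] F; first by rewrite !big_ord0 expr0n mul0r.
set s := \sum_(i < _) F i; set n := k.+1%:R.
have n0 : 0 < n by rewrite ltr0n.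
have : 0 <= \sum_(i < k.+1) (F i - s / n) ^+ 2.
  by apply: sumr_ge0 => i _; rewrite sqr_ge0.
under eq_bigr => i _ do rewrite sqrrB.
rewrite big_split sumrB /= sumrMnl -mulr_suml -/s.
rewrite sumr_const card_ord -[_ *+ k.+1]mulr_natr -/n.
set q := \sum_(i < _) _ => h.
have : 0 <= n * (q - s * (s / n) *+ 2 + (s / n) ^+ 2 * n).
  by apply: mulr_ge0 => //; apply: ltW.
have -> : n * (q - s * (s / n) *+ 2 + (s / n) ^+ 2 * n) = n * q - s ^+ 2.
  by field; rewrite gt_eqF.
by rewrite subr_ge0.
Qed.

(** Phases fixed at [z] give a polynomial equal to the sum of moduli at [z] and bounded by that sum
    elsewhere; the maximum principle applies to it. *)
Lemma sum_lagrange_le (R : realType) k (e : nat -> R[i]) B z :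
  (forall w, normc w = 1 -> \sum_(j < k) normc (lagrange e k j w) <= B) ->
  normc z <= 1 -> \sum_(j < k) normc (lagrange e k j z) <= B.
Proof.
move=> hB z1.
pose phase j := (normc (lagrange e k j z))%:C / lagrange e k j z.
pose p : {poly R[i]} := \sum_(j < k) (phase j)%:P *
  \prod_(i < k | i != j :> nat) (('X - (e i)%:P) * ((e j - e i)^-1)%:P).
have pE w : p.[w] = \sum_(j < k) phase j * lagrange e k j w.
  rewrite horner_sum; apply: eq_bigr => j _.
  rewrite hornerM hornerC horner_prod.
  by congr (_ * _); apply: eq_bigr => i _; rewrite !hornerE.
have nR (x : R) : 0 <= x -> normc x%:C = x.
  by move=> x0; rewrite /= expr0n addr0 sqrtr_sqr ger0_norm.
(* A phase is 0, not of modulus 1, where the fundamental polynomial vanishes at [z]. *)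
have phase1 j : normc (phase j) <= 1.
  rewrite Normc.normcM Normc.normcV nR ?normc_ge0 //.
  have [->|n0] := eqVneq (normc (lagrange e k j z)) 0.
    by rewrite mul0r ler01.
  by rewrite divff.
have <- : normc p.[z] = \sum_(j < k) normc (lagrange e k j z).
  rewrite pE (_ : \sum_(j < k) _ = (\sum_(j < k) normc (lagrange e k j z))%:C).
    by rewrite nR // sumr_ge0 // => j _; rewrite normc_ge0.
  rewrite rmorph_sum; apply: eq_bigr => j _; rewrite /phase.
  have [->|n0] := eqVneq (lagrange e k j z) 0.
    by rewrite mulr0 Normc.normc0.
  by rewrite mulfVK.
apply: maximum_principle z1 => w w1; apply: le_trans (hB _ w1).
rewrite pE; apply: le_trans (le_normc_sum _ _) _; apply: ler_sum => j _.
by rewrite Normc.normcM ler_piMl ?normc_ge0.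
Qed.

Unset Implicit Arguments.

Theorem theorem1 (R : realType) (k : nat) (hk : (1 <= k)%N)
    (s : nat) (p : 'I_s.+1 -> nat)
    (p_incr : forall i j : 'I_s.+1, (i < j)%N -> (p i < p j)%N)
    (k_binary : k = (\sum_(i < s.+1) 2 ^ p i)%N)
    (e : 'I_k -> R[i]) (he : leja_section e) :
  (lebesgue_constant e <= (2 `^ (- ((p ord0)%:R / 2)) * k%:R)%:E)%E.
Proof.
(* Extension of [e] by 0 to all of [nat]. *)
pose f n := oapp e 0 (insub n).
have fE (i : 'I_k) : f i = e i by rewrite /f valK.
have lejaE (m : 'I_k) z : leja_prod e m z = normc (nodal f m z).
  rewrite normc_prod (big_ord_widen k (fun j => normc (z - f j))) 1?ltnW //.
  by apply: eq_bigr => j _; rewrite fE.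
have lagE (j : 'I_k) z : lagrange_fun e j z = lagrange f k j z.
  by apply: eq_bigr => i _; rewrite !fE.
have hf : leja_seq k f.
  case: he => h1 h2 h3; split=> [m mk|k0|m mk z z1].
  - by rewrite (fE (Ordinal mk)); apply: h1.
  - by rewrite (fE (Ordinal k0)); apply: h2.
  have [->|m0] := posnP m; first by rewrite /nodal !big_ord0.
  by rewrite -!(lejaE (Ordinal mk)) (fE (Ordinal mk)); apply: h3.
(* [p ord0] is the least exponent, so its power of 2 divides every summand. *)
have pk : (2 ^ p ord0 %| k)%N.
  rewrite k_binary; apply: dvdn_sum => i _; apply: dvdn_exp2l.
  have [->//|i0] := eqVneq i ord0.
  by apply/ltnW/p_incr; rewrite lt0n.
apply: ge_ereal_sup => _ [z z1 <-]; rewrite lee_fin.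
under eq_bigr => j _ do rewrite lagE.
apply: sum_lagrange_le z1 => w w1.
set B := _ * _; have B0 : 0 <= B by rewrite mulr_ge0 ?powR_ge0.
(* Squaring reduces the goal to the quadratic bound, as B^2 = k (k / 2^p_0). *)
rewrite -ler_sqr ?nnegrE ?sumr_ge0 // => [|j _]; last exact: normc_ge0.
apply: le_trans (sqr_sum_le _) _.
have -> : B ^+ 2 = k%:R * (k%:R / 2 ^+ p ord0).
  rewrite exprMn powRN exprVn -[_ ^+ 2]powR_mulrn ?powR_ge0 // -powRrM.
  by rewrite mulfVK ?pnatr_eq0 // powR_mulrn //; ring.
apply: ler_wpM2l; first exact: ler0n.
by rewrite ler_pdivlMr ?exprn_gt0 // (quad_lebesgue_le hf).
Qed.
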